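(* Let $x^*=\min(x,1-x)$. Then $T(x)\asymp x^*\log_2\frac{1}{x^*}$ on $[0,1]$; that is, there exist universal constants $c,C>0$ such that \[ c\,x^*\log_2\frac{1}{x^*}\ \le\ T(x)\ \le\ C\,x^*\log_2\frac{1}{x^*}\qquad\text{for all }x\in[0,1]. \]
   Context: $T$ is the Takagi function $T(x)=\sum_{k=0}^\infty\frac{\operatorname{dist}(2^kx,\mathbb{Z})}{2^k}$, where $\operatorname{dist}(t,\mathbb{Z})$ is the distance from $t$ to the nearest integer. Convention: $0\log_2(1/0)=0$. *)

(* Defs.v *)
From mathcomp Require Import all_boot all_order all_algebra.
From mathcomp Require Import all_classical all_reals all_analysis.
Set Implicit Arguments.
Unset Strict Implicit.
Unset Printing Implicit Defensive.
Import Order.TTheory GRing.Theory Num.Theory.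
Import numFieldNormedType.Exports.
Local Open Scope classical_set_scope.
Local Open Scope ring_scope.

Definition dist_int (R : realType) (t : R) : R :=
  inf [set `|t - z%:~R| | z in [set: int]].

(* The limit exists for every x, see is_cvg_takagi. *)
Definition takagi (R : realType) (x : R) : R :=
  limn (series (fun k => dist_int (2 ^+ k * x) / 2 ^+ k)).

Definition log2 (R : realType) (x : R) : R := ln x / ln 2.

(* At x = 0 the value is 0, whatever log2 (1 / 0) is: this is the convention
   0 log2 (1/0) = 0. *)
Definition xlog2inv (R : realType) (x : R) : R := x * log2 (1 / x).

Lemma dist_int_ge0 (R : realType) (t : R) : 0 <= dist_int t.
Proof.
apply: lb_le_inf; first by exists `|t - 0%:~R|; exists 0.
by move=> _ [z _ <-].
Qed.

Lemma dist_int_le1 (R : realType) (t : R) : dist_int t <= 1.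
Proof.
apply: (@le_trans _ _ `|t - (Num.floor t)%:~R|).
  apply: ge_inf; last by exists (Num.floor t).
  by exists 0 => _ [z _ <-].
have /andP[h1 h2] := real_floor_itv (num_real t).
rewrite ger0_norm ?subr_ge0// lerBlDl ltW//.
by rewrite intrD in h2.
Qed.

Lemma is_cvg_takagi (R : realType) (x : R) :
  cvgn (series (fun k => dist_int (2 ^+ k * x) / 2 ^+ k)).
Proof.
apply: (@series_le_cvg _ _ (geometric 1 2^-1)).
- by move=> k; rewrite divr_ge0 ?dist_int_ge0 ?exprn_ge0.
- by move=> k; rewrite /geometric/= mul1r exprn_ge0 ?invr_ge0.
- by move=> k; rewrite /geometric/= mul1r exprVn ler_piMl ?dist_int_le1//.
- apply: is_cvg_geometric_series.
  by rewrite ger0_norm ?invr_ge0// invf_lt1 ?ltr1n.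
Qed.

(* Main.v *)
(* Let 0 < y <= 1/2 and n = floor (log2 (1 / y)), so that n >= 1 and
   2 ^ n <= 1 / y < 2 ^ (n + 1).  For k < n we have 2 ^ k y <= 1/2, hence the
   first n terms of the series of T y are all equal to y, while the remaining
   ones add up to at most 2 / 2 ^ n <= 4 y.  Thus n y <= T y <= (n + 4) y, and
   both bounds are comparable to y log2 (1 / y).  The other half of the
   interval follows from T (1 - x) = T x. *)
Require Import Defs.
From mathcomp Require Import all_boot all_order all_algebra.
From mathcomp Require Import all_classical all_reals all_analysis.
From mathcomp Require Import ring lra.
Import Order.TTheory GRing.Theory Num.Theory.
Import numFieldNormedType.Exports.
Local Open Scope classical_set_scope.
Local Open Scope ring_scope.

(** The substitution of [m - z] for [z] permutes the integers and matches the two sets of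
    distances. *)
Lemma dist_int_subz (R : realType) (m : int) (t : R) :
  dist_int (m%:~R - t) = dist_int t.
Proof.
rewrite /dist_int; congr inf; apply/seteqP; split => _ [z _ <-] /=;
  exists (m - z) => //; rewrite intrB distrC; congr `|_|; ring.
Qed.

(** Integers [z <= 0] lie at distance [t - z >= t], and integers [z >= 1] at distance at least
    [1 - t], which is [>= t] because [t <= 1 / 2]. *)
Lemma dist_int_id (R : realType) (t : R) : 0 <= t <= 1 / 2 -> dist_int t = t.
Proof.
move=> /andP[t0 t1]; apply/eqP; rewrite eq_le; apply/andP; split.
  apply: ge_inf; last by exists 0; rewrite // subr0 ger0_norm.
  by exists 0 => _ [z _ <-].
apply: lb_le_inf; first by exists `|t - 0%:~R|; exists 0.
move=> _ [z _ <-]; have [z0|z0] := lerP z 0.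
  have : z%:~R <= 0 :> R by rewrite lerz0.
  by move=> ?; rewrite ger0_norm; lra.
have : 1 <= z%:~R :> R by rewrite ler1z -gtz0_ge1.
by move=> ?; rewrite ler0_norm; lra.
Qed.

Lemma takagi_sub1 (R : realType) (x : R) : takagi (1 - x) = takagi x.
Proof.
rewrite /takagi; congr (limn (series _)); apply/funext => k.
have -> : 2 ^+ k * (1 - x) = (2 ^+ k)%:~R - 2 ^+ k * x :> R.
  by rewrite mulrBr mulr1 rmorphXn.
by rewrite dist_int_subz.
Qed.

Definition takagi_sum {R : realType} (x : R) : R^nat :=
  series (fun k => dist_int (2 ^+ k * x) / 2 ^+ k).

Lemma takagi_bounds {R : realType} (x : R) (n : nat) :
  takagi_sum x n <= takagi x <= takagi_sum x n + 2 / 2 ^+ n.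
Proof.
set s := takagi_sum x; have cs : cvgn s := @is_cvg_takagi R x.
apply/andP; split.
  apply: nondecreasing_cvgn_le cs n; apply: nondecreasing_series => k _ _.
  by rewrite divr_ge0 ?dist_int_ge0 ?exprn_ge0.
(* The term of index [n + m] is at most [1 / 2 ^+ (n + m)], exactly the amount by which the slack
   [2 / 2 ^+ (n + m)] shrinks at the next index. So partial sum plus slack never increases, and no
   tail has to be summed. *)
have tail m : s (n + m)%N + 2 / 2 ^+ (n + m) <= s n + 2 / 2 ^+ n.
  elim: m => [|m]; first by rewrite addn0.
  apply: le_trans; rewrite addnS /s /takagi_sum seriesSr exprS.
  have p : 0 < (2 ^+ (n + m) : R)^-1 by rewrite invr_gt0 exprn_gt0.
  have d := dist_int_le1 (2 ^+ (n + m) * x).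
  have : 2 / (2 * 2 ^+ (n + m)) = (2 ^+ (n + m))^-1 :> R.
    by field; rewrite expf_neq0.
  by move=> ->; nra.
apply: limr_le => //; near=> N.
have nN : (n <= N)%N by near: N; exists n.
rewrite -(subnKC nN); apply: le_trans (tail (N - n)%N).
by rewrite lerDl divr_ge0 ?exprn_ge0.
Unshelve. all: by end_near.
Qed.

Lemma takagi_sum_id (R : realType) (y : R) (n : nat) :
  0 <= y -> 2 ^+ n * y <= 1 ->
  takagi_sum y n = n%:R * y.
Proof.
move=> y0 ny; rewrite /takagi_sum seriesEnat /= (eq_big_nat _ _ (F2 := fun=> y)).
  by rewrite sumr_const_nat subn0 mulr_natl.
move=> k /andP[_ kn]; have k0 : 0 < 2 ^+ k :> R by rewrite exprn_gt0.
rewrite dist_int_id; first by field; rewrite gt_eqF.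
rewrite mulr_ge0 ?(ltW k0)//=.
(* Since [k < n], the exponent [k.+1] is still at most [n]; the spare factor 2 gives
   [2 ^+ k * y <= 1 / 2]. *)
have : 2 ^+ k.+1 * y <= 1.
  by apply: le_trans ny; rewrite ler_wpM2r// ler_eXn2l// ltr1n.
by rewrite exprS; lra.
Qed.

Lemma takagi_log2_bounds (R : realType) (y : R) : 0 <= y <= 1 / 2 ->
  1 / 2 * xlog2inv y <= takagi y <= 5 * xlog2inv y.
Proof.
rewrite le_eqVlt => /andP[/orP[/eqP <- _|y0 y1]].
  have -> : takagi 0 = 0 :> R.
    rewrite /takagi (_ : (fun k => _) = cst 0).
      by apply: cvg_lim => //; rewrite (_ : series _ = cst 0);
        [exact: cvg_cst | apply/funext => n; rewrite seriesEnat /= big1].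
    by apply/funext => k; rewrite mulr0 dist_int_id ?mul0r// lexx/=; lra.
  by rewrite /xlog2inv mul0r !mulr0 lexx.
have ln2 : 0 < ln 2 :> R by rewrite ln_gt0// ltr1n.
have V0 : 0 < 1 / y by rewrite divr_gt0.
have lnE k : ln (2 ^+ k) = k%:R * ln 2 :> R by rewrite lnXn// mulr_natl.
(* This equivalence turns the bounds of [L] by [n] and [n + 1] into bounds of [1 / y] by powers of
   2. *)
have log2_ge k : (k%:R <= log2 (1 / y)) = (2 ^+ k <= 1 / y).
  by rewrite ler_pdivlMr// -lnE ler_ln// posrE exprn_gt0.
have L1 : 1 <= log2 (1 / y).
  by rewrite (log2_ge 1%N) expr1 ler_pdivlMr//; lra.
rewrite /xlog2inv; set L := log2 (1 / y) in log2_ge L1 *.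
have [n nL Ln] : exists2 n, n%:R <= L & L < n%:R + 1.
  have /truncn_itv/andP[lo hi] : 0 <= L by lra.
  by exists (Num.truncn L); rewrite ?natr1.
have n1 : 1 <= n%:R :> R.
  by rewrite ler1n lt0n; apply/eqP => n0; move: Ln; rewrite n0; lra.
have ny : 2 ^+ n * y <= 1 by rewrite -ler_pdivlMr// -log2_ge.
have ny' : 2 / 2 ^+ n <= 4 * y.
  rewrite ler_pdivrMr ?exprn_gt0//.
  have : ~~ (2 ^+ n.+1 <= 1 / y) by rewrite -log2_ge -ltNge -natr1.
  by rewrite -ltNge ltr_pdivrMr// exprS; lra.
have /andP[] := takagi_bounds y n.
rewrite takagi_sum_id ?(ltW y0)// => lo hi.
(* The constant 1/2 comes from [L < n + 1 <= 2 n], the constant 5 below from [n + 4 <= L + 4 L];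
   these use [1 <= n] and [1 <= L] respectively. *)
have lo' : 1 / 2 * L * y <= n%:R * y by rewrite ler_pM2r//; lra.
have hi' : (n%:R + 4) * y <= 5 * L * y by rewrite ler_pM2r//; lra.
by apply/andP; split; lra.
Qed.

Theorem proposition1p10 (R : realType) :
  exists c C : R, 0 < c /\ 0 < C /\
    forall x : R, 0 <= x <= 1 ->
      c * xlog2inv (Num.min x (1 - x)) <= takagi x /\
      takagi x <= C * xlog2inv (Num.min x (1 - x)).
Proof.
exists (1 / 2), 5; split; [lra | split; [lra | move=> x /andP[x0 x1]]].
apply/andP; have [h|h] := leP x (1 - x).
  by apply: takagi_log2_bounds; apply/andP; split; lra.
by rewrite -takagi_sub1; apply: takagi_log2_bounds; apply/andP; split; lra.
Qed.
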